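(* Let $n\in\omega$, let $Z_n=\{y_1,\dots,y_{n+1}\}$ be a set of variables and let $\mathbb{Z}_{n,1}=\langle Z_n;\leq_1\rangle,\dots,\mathbb{Z}_{n,k_n}=\langle Z_n;\leq_{k_n}\rangle$ be an enumeration of all partial orders on $Z_n$. For $k\leq k_n$ put \[\psi_{n,k}\coloneqq\bigvee_{i=1}^{n+1}\Big(y_i\to\big(x\vee\bigvee_{j\colon y_i\nleq_k y_j}y_j\big)\Big),\qquad \delta_{n,k}\coloneqq\psi_{n,k}\vee\Big(x\to\bigvee_{i=1}^{n+1}y_i\Big),\] where an empty disjunction is the constant $0$, and let $\Sigma_n\coloneqq\{\delta_{n,k}\approx 1: k=1,\dots,k_n\}$. Then a Heyting algebra has incomparability degree at most $n$ if and only if it satisfies all equations in $\Sigma_n$. Consequently, the class $\mathsf{ID}_n$ of Heyting algebras of incomparability degree at most $n$ is a variety.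
   Context: Heyting algebras are algebras $\langle A;\wedge,\vee,\to,0,1\rangle$. For a Heyting algebra $\mathbf{A}$, $\mathbf{A}_\ast$ is the set of its prime filters ordered by inclusion (its dual Esakia space). A poset has incomparability degree at most $n$ if for every element $x$, the set ${\uparrow}x$ contains no point that is incomparable with $n+1$ distinct elements (of ${\uparrow}x$); a Heyting algebra has incomparability degree at most $n$ if the poset underlying $\mathbf{A}_\ast$ does. *)

(* Defs.v *)
From mathcomp Require Import all_boot.
Set Implicit Arguments.
Unset Strict Implicit.
Unset Printing Implicit Defensive.

Record halg := HAlg {
  carrier :> Type;
  meet : carrier -> carrier -> carrier;
  join : carrier -> carrier -> carrier;
  imp : carrier -> carrier -> carrier;
  bot : carrier;
  top : carrier }.

Arguments meet {h} _ _.
Arguments join {h} _ _.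
Arguments imp {h} _ _.
Arguments bot {h}.
Arguments top {h}.

Definition hle (A : halg) (a b : A) : Prop := meet a b = a.

Record heyting (A : halg) : Prop := Heyting {
  meetC : forall a b : A, meet a b = meet b a;
  joinC : forall a b : A, join a b = join b a;
  meetA : forall a b c : A, meet a (meet b c) = meet (meet a b) c;
  joinA : forall a b c : A, join a (join b c) = join (join a b) c;
  meet_absorb : forall a b : A, meet a (join a b) = a;
  join_absorb : forall a b : A, join a (meet a b) = a;
  bot_least : forall a : A, hle bot a;
  top_greatest : forall a : A, hle a top;
  residuation : forall a b c : A, hle (meet a b) c <-> hle a (imp b c) }.

Inductive term (V : Type) : Type :=
  | Var of V
  | Meet of term V & term V
  | Join of term V & term V
  | Imp of term V & term V
  | Bot
  | Top.

Arguments Bot {V}.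
Arguments Top {V}.

Fixpoint eval (V : Type) (A : halg) (v : V -> A) (t : term V) : A :=
  match t with
  | Var x => v x
  | Meet s t => meet (eval v s) (eval v t)
  | Join s t => join (eval v s) (eval v t)
  | Imp s t => imp (eval v s) (eval v t)
  | Bot => bot
  | Top => top
  end.

Definition equation (V : Type) : Type := (term V * term V)%type.

Definition satisfies (V : Type) (A : halg) (e : equation V) : Prop :=
  forall v : V -> A, eval v e.1 = eval v e.2.

Definition satisfies_all (V : Type) (A : halg) (E : equation V -> Prop) : Prop :=
  forall e, E e -> satisfies A e.

(* A variety is a class of algebras of the given similarity type closed under
   homomorphic images, subalgebras and direct products (of arbitrary, possibly
   empty, families). *)

Record hom (A B : halg) (f : A -> B) : Prop := Hom {
  hom_meet : forall a b, f (meet a b) = meet (f a) (f b);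
  hom_join : forall a b, f (join a b) = join (f a) (f b);
  hom_imp : forall a b, f (imp a b) = imp (f a) (f b);
  hom_bot : f bot = bot;
  hom_top : f top = top }.

Record subuniverse (A : halg) (S : A -> Prop) : Prop := Subuniverse {
  sub_meet : forall a b, S a -> S b -> S (meet a b);
  sub_join : forall a b, S a -> S b -> S (join a b);
  sub_imp : forall a b, S a -> S b -> S (imp a b);
  sub_bot : S bot;
  sub_top : S top }.

Definition subalgebra (A : halg) (S : A -> Prop) (hS : subuniverse S) : halg :=
  @HAlg {a : A | S a}
    (fun a b => exist S _ (sub_meet hS (svalP a) (svalP b)))
    (fun a b => exist S _ (sub_join hS (svalP a) (svalP b)))
    (fun a b => exist S _ (sub_imp hS (svalP a) (svalP b)))
    (exist S _ (sub_bot hS))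
    (exist S _ (sub_top hS)).

Definition product (I : Type) (A : I -> halg) : halg :=
  @HAlg (forall i, A i)
    (fun a b i => meet (a i) (b i))
    (fun a b i => join (a i) (b i))
    (fun a b i => imp (a i) (b i))
    (fun i => bot)
    (fun i => top).

Record variety (K : halg -> Prop) : Prop := Variety {
  closed_H : forall (A B : halg) (f : A -> B),
    hom f -> (forall b, exists a, f a = b) -> K A -> K B;
  closed_S : forall (A : halg) (S : A -> Prop) (hS : subuniverse S),
    K A -> K (subalgebra hS);
  closed_P : forall (I : Type) (A : I -> halg),
    (forall i, K (A i)) -> K (product A) }.

Record prime_filter (A : halg) (F : A -> Prop) : Prop := PrimeFilter {
  pf_top : F top;
  pf_up : forall a b, hle a b -> F a -> F b;
  pf_meet : forall a b, F a -> F b -> F (meet a b);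
  pf_proper : ~ F bot;
  pf_prime : forall a b, F (join a b) -> F a \/ F b }.

Definition dual (A : halg) : Type := {F : A -> Prop | prime_filter F}.

Definition dual_le (A : halg) (F G : dual A) : Prop :=
  forall a, sval F a -> sval G a.

Definition incomparable (P : Type) (le : P -> P -> Prop) (y z : P) : Prop :=
  ~ le y z /\ ~ le z y.

Definition poset_incomp_degree_le (P : Type) (le : P -> P -> Prop) (n : nat) :
    Prop :=
  forall x : P, ~ exists (y : P) (z : 'I_n.+1 -> P),
    [/\ le x y, injective z, forall i, le x (z i)
      & forall i, incomparable le y (z i)].

Definition incomp_degree_le (n : nat) (A : halg) : Prop :=
  poset_incomp_degree_le (@dual_le A) n.

Definition ID (n : nat) (A : halg) : Prop := heyting A /\ incomp_degree_le n A.

(* The variable y_{i+1} is [Some i], and x is [None]. *)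
Definition vars (n : nat) : Type := option 'I_n.+1.
Definition xvar (n : nat) : term (vars n) := Var None.
Definition yvar (n : nat) (i : 'I_n.+1) : term (vars n) := Var (Some i).

Definition partial_order (T : Type) (le : rel T) : Prop :=
  [/\ reflexive le, antisymmetric le & transitive le].

Definition po_enumeration (n k : nat) (le_ : 'I_k -> rel 'I_n.+1) : Prop :=
  (forall i, partial_order (le_ i)) /\
  (forall le : rel 'I_n.+1, partial_order le -> exists i, le =2 le_ i).

Lemma po_enumeration_exists (n : nat) :
  exists (k : nat) (le_ : 'I_k -> rel 'I_n.+1), po_enumeration le_.
Proof.
pose T := {ffun 'I_n.+1 * 'I_n.+1 -> bool}.
pose r (f : T) : rel 'I_n.+1 := fun i j => f (i, j).
pose p (f : T) := [&& [forall i, r f i i],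
  [forall i, forall j, (r f i j && r f j i) ==> (i == j)] &
  [forall j, forall i, forall k, r f i j ==> r f j k ==> r f i k]].
exists #|p|, (fun i => r (enum_val i)); split=> [i|le [ler lea let_]].
  have /and3P[/forallP h1 /forallP h2 /forallP h3] : p (enum_val i) by exact: (enum_valP i).
  split=> // [x y xy|y x z xy yz].
    by have /forallP/(_ y)/implyP/(_ xy)/eqP := h2 x.
  by have /forallP/(_ x)/forallP/(_ z)/implyP/(_ xy)/implyP/(_ yz) := h3 y.
pose f : T := [ffun ij => le ij.1 ij.2].
have rE : r f =2 le by move=> i j; rewrite /r ffunE.
have pf : f \in p.
  apply/and3P; split; apply/forallP=> x; rewrite ?rE //; apply/forallP=> y.
    by rewrite !rE; apply/implyP=> /lea ->.
  by apply/forallP=> z; rewrite !rE; apply/implyP=> xy; apply/implyP; apply: let_.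
by exists (enum_rank_in pf f) => i j; rewrite enum_rankK_in // rE.
Qed.

(* Finite disjunctions are right-nested and end in [Bot], which does not affect
   their value in a Heyting algebra. *)
Definition psi (n : nat) (le : rel 'I_n.+1) : term (vars n) :=
  \big[@Join _/Bot]_(i < n.+1)
    Imp (yvar i) (Join (xvar n) (\big[@Join _/Bot]_(j < n.+1 | ~~ le i j) yvar j)).

Definition delta (n : nat) (le : rel 'I_n.+1) : term (vars n) :=
  Join (psi le) (Imp (xvar n) (\big[@Join _/Bot]_(i < n.+1) yvar i)).

Definition Sigma (n k : nat) (le_ : 'I_k -> rel 'I_n.+1) :
    equation (vars n) -> Prop :=
  fun e => exists i : 'I_k, e = (delta (le_ i), Top).

(* Main.v *)
From mathcomp Require Import boolp classical_sets.
Require Import Defs.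
From mathcomp Require Import all_boot.

Set Implicit Arguments.
Unset Strict Implicit.
Unset Printing Implicit Defensive.

(* If prime filters [Q] and [R_i], all containing [P], witness that the degree
   exceeds [n], order the indices by reverse inclusion of the [R_i].  Finite
   meets give [a] in [Q] outside every [R_i], and [b_i] in [R_i] outside [Q] and
   outside every [R_j] not containing [R_i]; under [x := a], [y_i := b_i] no
   disjunct of [delta] lies in [P].  Conversely, if [delta] is not [1], a prime
   filter [P] omits it, and every disjunct [b -> c] of [delta] yields a prime
   filter above [P] containing [b] and omitting [c]; these filters are the [R_i]
   and [Q].  Finally, Heyting algebras are equationally defined, and equational
   classes are varieties. *)

(** * Order and residuation in a Heyting algebra *)

Section HeytingOrder.
Variables (A : halg) (hA : heyting A).
Implicit Types a b c d : A.

Lemma hle_refl a : hle a a.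
Proof. by rewrite /hle -{2}(join_absorb hA a a) meet_absorb. Qed.

Lemma hle_trans b a c : hle a b -> hle b c -> hle a c.
Proof. by rewrite /hle => ab bc; rewrite -ab -(meetA hA) bc. Qed.

Lemma hle_anti a b : hle a b -> hle b a -> a = b.
Proof. by rewrite /hle => ab ba; rewrite -ab (meetC hA). Qed.

Lemma meet_lel a b : hle (meet a b) a.
Proof. by rewrite /hle (meetC hA) (meetA hA) hle_refl. Qed.

Lemma meet_ler a b : hle (meet a b) b.
Proof. by rewrite (meetC hA); exact: meet_lel. Qed.

Lemma hle_meet a b c : hle c a -> hle c b -> hle c (meet a b).
Proof. by rewrite /hle => ca cb; rewrite (meetA hA) ca. Qed.

Lemma hle_joinl a b : hle a (join a b).
Proof. exact: meet_absorb. Qed.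

Lemma hle_joinr a b : hle b (join a b).
Proof. by rewrite (joinC hA); exact: hle_joinl. Qed.

Lemma join_hle a b c : hle a c -> hle b c -> hle (join a b) c.
Proof.
have leE (x y : A) : hle x y -> join x y = y.
  by rewrite /hle => xy; rewrite -xy (joinC hA) [meet x y](meetC hA) join_absorb.
by move=> /leE ac /leE bc; rewrite -bc -ac (joinA hA) [join b a](joinC hA);
  exact: hle_joinl.
Qed.

Lemma hle_imp_intro a b c : hle (meet a b) c -> hle a (imp b c).
Proof. by move/(residuation hA). Qed.

Lemma hle_imp_elim a b c : hle a (imp b c) -> hle (meet a b) c.
Proof. by move/(residuation hA). Qed.

Lemma imp_mp b c : hle (meet (imp b c) b) c.
Proof. exact/hle_imp_elim/hle_refl. Qed.

Lemma imp_homo b c d : hle c d -> hle (imp b c) (imp b d).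
Proof. by move=> cd; apply: hle_imp_intro; exact: hle_trans (imp_mp b c) cd. Qed.

Lemma hle_imp b c : hle c (imp b c).
Proof. exact/hle_imp_intro/meet_lel. Qed.

Lemma top_le_impxx b : hle top (imp b b).
Proof. exact/hle_imp_intro/meet_ler. Qed.

Lemma meet_imp b c d : hle (meet (imp b c) (imp b d)) (imp b (meet c d)).
Proof.
apply: hle_imp_intro; apply: hle_meet.
  by apply: hle_imp_elim; exact: meet_lel.
by apply: hle_imp_elim; exact: meet_ler.
Qed.

Lemma imp_join a b c : hle (meet (imp a c) (imp b c)) (imp (join a b) c).
Proof.
apply: hle_imp_intro; rewrite (meetC hA); apply: hle_imp_elim.
apply: join_hle; apply: hle_imp_intro; rewrite (meetC hA); apply: hle_imp_elim.
  exact: meet_lel.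
exact: meet_ler.
Qed.

End HeytingOrder.

(** * Filters, Zorn's lemma and separation by prime filters *)

Section PrimeFilters.
Variables (A : halg) (hA : heyting A).

(** Improper filters are allowed: Zorn's lemma is run on filters omitting a chosen [c], and
    properness follows from that omission. *)
Record lattice_filter (F : A -> Prop) : Prop := LatticeFilter {
  lf_top : F top;
  lf_up : forall a b, hle a b -> F a -> F b;
  lf_meet : forall a b, F a -> F b -> F (meet a b) }.

Lemma prime_filter_filter F : prime_filter F -> lattice_filter F.
Proof. by case. Qed.

Lemma lattice_filter_top : lattice_filter (fun a => a = top).
Proof.
split=> [//|a b + ta|a b -> ->]; last exact: hle_refl.
by rewrite ta => tb; apply: (hle_anti hA) => //; exact: top_greatest.
Qed.

Lemma filter_mp F b c : lattice_filter F -> F (imp b c) -> F b -> F c.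
Proof. by move=> fF Fbc Fb; apply: (lf_up fF (imp_mp hA b c)); exact: lf_meet. Qed.

(* The filter generated by [F] and [b]. *)
Lemma filter_imp F b : lattice_filter F -> lattice_filter (fun d => F (imp b d)).
Proof.
move=> fF; split=> [|c d cd|c d Fc Fd].
- by apply: (lf_up fF) (lf_top fF); exact: hle_imp.
- by apply: (lf_up fF); exact: imp_homo.
- by apply: (lf_up fF (meet_imp hA b c d)); exact: lf_meet.
Qed.

(** Two elements of the union already lie together in the larger of their two filters. This supplies
    upper bounds for Zorn's lemma. *)
Lemma chain_filter (C : (A -> Prop) -> Prop) :
    (forall F, C F -> lattice_filter F) -> (exists F, C F) ->
    (forall F G, C F -> C G -> (forall a, F a -> G a) \/ (forall a, G a -> F a)) ->
  lattice_filter (fun a => exists2 F, C F & F a).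
Proof.
move=> fC [F0 CF0] tot; split.
- by exists F0 => //; exact: lf_top (fC F0 CF0).
- by move=> a b ab [F CF Fa]; exists F => //; exact: (lf_up (fC F CF) ab).
- move=> a b [F CF Fa] [G CG Gb]; have [FG|GF] := tot F G CF CG.
    by exists G => //; apply: (lf_meet (fC G CG)) => //; exact: FG.
  by exists F => //; apply: (lf_meet (fC F CF)) => //; exact: GF.
Qed.

Lemma maximal_filter F c : lattice_filter F -> ~ F c ->
  exists G, [/\ lattice_filter G, forall a, F a -> G a, ~ G c &
    forall H, lattice_filter H -> (forall a, G a -> H a) -> ~ H c ->
      forall a, H a -> G a].
Proof.
move=> fF nFc.
pose K G := [/\ lattice_filter G, forall a, F a -> G a & ~ G c].
pose T := {G : A -> Prop | K G}; have KF : K F by [].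
pose R (G H : T) := `[< forall a, sval G a -> sval H a >].
have [||C totC|[G [fG FG nGc]] maxG] := @ZL_preorder T (exist K F KF) R.
- by move=> G; exact/asboolP.
- by move=> G H J /asboolP GH /asboolP HJ; apply/asboolP => a /GH /HJ.
(* The empty chain is bounded by [F] itself, a nonempty one by its union. *)
- case: (pselect (exists G, C G)) => [[G0 CG0]|C0]; last first.
    by exists (exist K F KF) => G CG; case: C0; exists G.
  pose D G := exists2 t : T, C t & sval t = G.
  have KU : K (fun a => exists2 G, D G & G a).
    split.
    - apply: chain_filter; last 2 first.
      + by exists (sval G0), G0.
      + move=> _ _ [G CG <-] [H CH <-].
        by have [/asboolP|/asboolP] := totC G H CG CH; [left|right].
      by move=> _ [[G [fG ? ?]] _ <-].
    - move=> a Fa; exists (sval G0); first by exists G0.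
      by case: (svalP G0) => _ + _; exact.
    - by move=> [_ [[G [fG FG nGc]] _ <-]].
  exists (exist K _ KU) => G CG; apply/asboolP => a Ga.
  by exists (sval G) => //; exists G.
exists G; split=> // H fH GH nHc a Ha.
have KH : K H by split=> // d /FG /GH.
by have /asboolP := maxG (exist K H KH) (asboolT GH); exact.
Qed.

(** A filter [G] maximal among those omitting [c] is prime: if [d] is outside [G], the filter
    generated by [G] and [d] contains [c], so [imp d c] is in [G]. Two such implications together
    with [join a b] in [G] would put [c] in [G]. *)
Lemma prime_filter_extension F c : lattice_filter F -> ~ F c ->
  exists G : dual A, (forall a, F a -> sval G a) /\ ~ sval G c.
Proof.
move=> fF nFc; have [G [fG FG nGc maxG]] := maximal_filter fF nFc.
have extG d : ~ G d -> G (imp d c).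
  move=> nGd; apply: contrapT => nGdc; apply: nGd.
  apply: (maxG (fun e => G (imp d e))) => //; first exact: filter_imp.
    by move=> a; apply: (lf_up fG); exact: hle_imp.
  exact: (lf_up fG (top_le_impxx hA d) (lf_top fG)).
have pG : prime_filter G.
  split; [exact: lf_top|exact: lf_up|exact: lf_meet| |].
    by move=> /(lf_up fG (bot_least hA c)).
  move=> a b Gab; apply: contrapT => /not_orP[/extG Ga /extG Gb]; apply: nGc.
  apply: (filter_mp fG) Gab; apply: (lf_up fG (imp_join hA a b c)).
  exact: lf_meet.
by exists (exist _ G pG).
Qed.

(** The hypothesis says that the filter generated by [P] and [b] omits [c], so it extends to a prime
    filter omitting [c]. *)
Lemma prime_filter_imp (P : dual A) b c : ~ sval P (imp b c) ->
  exists Q : dual A, [/\ dual_le P Q, sval Q b & ~ sval Q c].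
Proof.
move=> nPbc; have fP := prime_filter_filter (svalP P).
have [Q [PQ nQc]] := prime_filter_extension (filter_imp b fP) nPbc.
exists Q; split=> // [a Pa|].
  by apply: PQ; apply: (lf_up fP) Pa; exact: hle_imp.
by apply: PQ; exact: (lf_up fP (top_le_impxx hA b) (lf_top fP)).
Qed.

Lemma dual_le_anti (F G : dual A) : dual_le F G -> dual_le G F -> F = G.
Proof.
case: F G => [F pF] [G pG] FG GF; apply/eq_exist/predeqP => a.
by split; [exact: FG|exact: GF].
Qed.

Lemma separating_element (I : finType) (F : dual A) (G : I -> dual A) :
  exists a, sval F a /\ forall i, ~ dual_le F (G i) -> ~ sval (G i) a.
Proof.
suff [a [Fa Ga]] : exists a, sval F a /\
    forall i, i \in enum I -> ~ dual_le F (G i) -> ~ sval (G i) a.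
  by exists a; split=> // i; apply: Ga; rewrite mem_enum.
elim: (enum I) => [|i s [a [Fa Ga]]].
  by exists top; split=> //; exact: pf_top (svalP F).
have [b [Fb Gb]] : exists b, sval F b /\ (~ dual_le F (G i) -> ~ sval (G i) b).
  (* If [F] is below [G i], nothing has to be avoided and any element of [F] serves. *)
  case: (pselect (dual_le F (G i))) => [FG|/existsNP[b /not_implyP[Fb nGb]]].
    by exists a.
  by exists b.
exists (meet b a); split; first exact: (pf_meet (svalP F) Fb Fa).
move=> j; rewrite inE => /orP[/eqP->|js] nFG Gba.
  by apply: (Gb nFG); apply: (pf_up (svalP (G i)) _ Gba); exact: meet_lel.
apply: (Ga j js nFG); apply: (pf_up (svalP (G j)) _ Gba); exact: meet_ler.
Qed.

End PrimeFilters.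

(** * Finite disjunctions under evaluation *)

Section Disjunctions.
Variables (A : halg) (hA : heyting A) (V : Type) (v : V -> A).

Lemma prime_filter_bigjoin (P : A -> Prop) (I : Type) (r : seq I) (p : pred I)
    (t : I -> term V) : prime_filter P ->
  P (eval v (\big[@Join V/Bot]_(i <- r | p i) t i)) ->
  exists2 i, p i & P (eval v (t i)).
Proof.
move=> pP; elim/big_rec: _ => [/= /(pf_proper pP)//|i s pi IH /= /(pf_prime pP)].
by case=> // Pi; exists i.
Qed.

Lemma hle_bigjoin (I : finType) (p : pred I) (t : I -> term V) i : p i ->
  hle (eval v (t i)) (eval v (\big[@Join V/Bot]_(j | p j) t j)).
Proof.
move=> pi; have := mem_index_enum i; elim: (index_enum I) => // j r IH.
rewrite inE big_cons => /orP[/eqP<-|ir].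
  by rewrite pi; exact: hle_joinl.
case: ifP => _; last exact: IH.
by apply: (hle_trans hA) (IH ir) _; exact: hle_joinr.
Qed.

End Disjunctions.

(** Needed because an enumeration lists the partial orders only up to pointwise equality. *)
Lemma eq_delta n (le le' : rel 'I_n.+1) : le =2 le' -> delta le = delta le'.
Proof.
move=> e; rewrite /delta /psi; congr Join; apply: eq_bigr => i _.
by congr (Imp _ (Join _ _)); apply: eq_bigl => j; rewrite e.
Qed.

(** * The two directions between incomparability degree and equations *)

Lemma incomp_degree_delta (n : nat) (A : halg) (le : rel 'I_n.+1) :
    heyting A -> partial_order le -> incomp_degree_le n A ->
  satisfies A (delta le, Top).
Proof.
move=> hA [lexx lean _] idA v /=.
set d := join _ _; apply: contrapT => d1.
have [P [_ nPd]] := prime_filter_extension hA (lattice_filter_top hA) d1.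
pose a := v None; pose b i := v (Some i).
(* [z i] refutes the [i]-th disjunct of [psi]; the last clause is the contrapositive of omitting
   every [b j] with [~~ le i j]. *)
have /choice[z zP] : forall i, exists R : dual A, [/\ dual_le P R,
    sval R (b i), ~ sval R a & forall j, sval R (b j) -> le i j].
  move=> i.
  pose c : term (vars n) := Join (xvar n)
    (\big[@Join _/Bot]_(j < n.+1 | ~~ le i j) yvar j).
  have [Pi|R [PR Rb nRc]] := @prime_filter_imp A hA P (b i) (eval v c).
    apply: nPd; apply: (pf_up (svalP P) (hle_joinl hA _ _)).
    by apply: (pf_up (svalP P) _ Pi); exact: (@hle_bigjoin A hA _ v _ xpredT
      (fun i => Imp (yvar i) (Join (xvar n)
        (\big[@Join _/Bot]_(j < n.+1 | ~~ le i j) yvar j)))).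
  exists R; split=> // [Ra|j Rbj]; first apply: nRc.
    exact: (pf_up (svalP R) (hle_joinl hA _ _) Ra).
  apply: contrapT => /negP nij; apply: nRc => /=.
  apply: (pf_up (svalP R) (hle_joinr hA _ _)).
  by apply: (pf_up (svalP R) _ Rbj); exact: (@hle_bigjoin A hA _ v _ _ (@yvar n)).
have [PQ|Q [PQ Qa nQb]] := @prime_filter_imp A hA P a
    (eval v (\big[@Join _/Bot]_(i < n.+1) yvar i)).
  by apply: nPd; apply: (pf_up (svalP P) (hle_joinr hA _ _)).
have nQ i : ~ sval Q (b i).
  move=> Qbi; apply: nQb; apply: (pf_up (svalP Q) _ Qbi).
  exact: (@hle_bigjoin A hA _ v _ _ (@yvar n)).
apply: (idA P); exists Q, z; split=> // [i j zij|i|i].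
(* If [z i = z j], this filter contains both [b i] and [b j], so [le i j] and [le j i], and
   antisymmetry applies. *)
- have [_ bi _ lei] := zP i; have [_ bj _ lej] := zP j.
  by apply: lean; rewrite lei ?zij // lej // -zij.
- by case: (zP i).
(* The element [a] separates [Q] from [z i], and [b i] separates [z i] from [Q]. *)
- have [_ bi nai _] := zP i.
  by split=> [/(_ a Qa)//|/(_ _ bi)]; exact: nQ.
Qed.

Lemma delta_incomp_degree (n : nat) (A : halg) : heyting A ->
    (forall le : rel 'I_n.+1, partial_order le -> satisfies A (delta le, Top)) ->
  incomp_degree_le n A.
Proof.
move=> hA satA P [Q [z [PQ zinj Pz Qz]]].
(* With this direction, [z i] can omit every [b j] with [~~ le i j], as the inner disjunction of
   [psi] requires. *)
pose le : rel 'I_n.+1 := fun i j => `[< dual_le (z j) (z i) >].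
have po : partial_order le.
  split=> [i|i j /andP[/asboolP ij /asboolP ji]|j i k /asboolP ij /asboolP jk].
  - exact/asboolP.
  - exact/zinj/dual_le_anti.
  - by apply/asboolP => a /jk /ij.
have [a [Qa za]] := separating_element hA Q z.
have /choice[b bP] : forall i, exists b, [/\ sval (z i) b, ~ sval Q b
    & forall j, ~~ le j i -> ~ sval (z j) b].
  move=> i.
  (* The family indexed by [option] adds [Q], at [None], to the filters to be avoided. *)
  have [b [zb nb]] := separating_element hA (z i) (oapp z Q).
  exists b; split=> // [|j /asboolPn nij].
    by apply: (nb None); case: (Qz i).
  exact: (nb (Some j)).
pose v (x : vars n) := oapp b a x.
have fz i := prime_filter_filter (svalP (z i)).
have /= dtop := satA le po v.
have := pf_top (svalP P); rewrite -dtop => /(pf_prime (svalP P))[].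
  (* A disjunct of [psi] in [P] is also in [z i]; modus ponens with [b i] then puts [a] or some
     [b j] with [~~ le i j] in [z i], and both are excluded. *)
  move=> /(prime_filter_bigjoin (svalP P))[i _ /= /(Pz i) zi].
  have [bi _ _] := bP i.
  have /(pf_prime (svalP (z i)))[] := filter_mp hA (fz i) zi bi.
    by apply: za; case: (Qz i).
  move=> /(prime_filter_bigjoin (svalP (z i)))[j nij].
  by case: (bP j) => _ _; exact.
(* The remaining disjunct would put some [b i] in [Q]. *)
move=> /PQ Qab.
have := filter_mp hA (prime_filter_filter (svalP Q)) Qab Qa.
by move=> /(prime_filter_bigjoin (svalP Q))[i _]; case: (bP i).
Qed.

Lemma incomp_degree_Sigma (n k : nat) (le_ : 'I_k -> rel 'I_n.+1) (A : halg) :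
    po_enumeration le_ -> heyting A ->
  incomp_degree_le n A <-> satisfies_all A (Sigma le_).
Proof.
move=> [po_le le_po] hA; split=> [idA _ [i ->]|satA].
  exact: incomp_degree_delta.
apply: delta_incomp_degree => // le /le_po[i lei].
by rewrite (eq_delta lei); apply: satA; exists i.
Qed.

(** * Equational classes are varieties *)

Section EquationalClasses.
Variable V : Type.

Lemma eval_hom (A B : halg) (f : A -> B) (v : V -> A) (t : term V) :
  hom f -> eval (f \o v) t = f (eval v t).
Proof.
by case=> fM fJ fI f0 f1; elim: t => //= s -> t ->.
Qed.

Lemma hom_sval (A : halg) (S : A -> Prop) (hS : subuniverse S) :
  hom (sval : subalgebra hS -> A).
Proof. by []. Qed.

Lemma hom_proj (I : Type) (A : I -> halg) (i : I) :
  hom (fun a : product A => a i).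
Proof. by []. Qed.

Lemma variety_equational (E : equation V -> Prop) :
  variety (fun A => satisfies_all A E).
Proof.
split=> [A B f fhom fsurj EA e Ee v|A S hS EA e Ee v|I A EA e Ee v].
(* Surjectivity lifts a valuation in [B] to one in [A], where the equation holds. *)
- have [u uP] := choice (fun x => fsurj (v x)).
  have -> : v = f \o u by apply: funext => x; rewrite /= uP.
  by rewrite !eval_hom // EA.
- suff : sval (eval v e.1) = sval (eval v e.2).
    by case: (eval v e.1) (eval v e.2) => [a Sa] [b Sb] /=; exact: eq_exist.
  by rewrite -!(eval_hom _ _ (hom_sval hS)); exact: EA.
- apply: functional_extensionality_dep => i.
  by rewrite -!(eval_hom v _ (hom_proj A i)); exact: EA.
Qed.

End EquationalClasses.

(** The Heyting axioms have variables in [nat] and [Sigma] has them in [vars n], so the classes are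
    intersected rather than the sets of equations united. *)
Lemma variety_and (K L : halg -> Prop) :
  variety K -> variety L -> variety (fun A => K A /\ L A).
Proof.
move=> [KH KS KP] [LH LS LP]; split.
- by move=> A B f fh fs [/(KH _ _ _ fh fs) ? /(LH _ _ _ fh fs)].
- by move=> A S hS [/KS ? /LS].
- by move=> I A KLA; split; [apply: KP|apply: LP] => i; case: (KLA i).
Qed.

(** * An equational axiomatization of Heyting algebras *)

Section HeytingAxioms.
Local Notation x := (Var 0).
Local Notation y := (Var 1).
Local Notation z := (Var 2).

(* The last three equations express residuation. *)
Variant heyting_axiom : equation nat -> Prop :=
  | Ax_meetC : heyting_axiom (Meet x y, Meet y x)
  | Ax_joinC : heyting_axiom (Join x y, Join y x)
  | Ax_meetA : heyting_axiom (Meet x (Meet y z), Meet (Meet x y) z)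
  | Ax_joinA : heyting_axiom (Join x (Join y z), Join (Join x y) z)
  | Ax_meet_absorb : heyting_axiom (Meet x (Join x y), x)
  | Ax_join_absorb : heyting_axiom (Join x (Meet x y), x)
  | Ax_bot : heyting_axiom (Meet Bot x, Bot)
  | Ax_top : heyting_axiom (Meet x Top, x)
  | Ax_mp : heyting_axiom (Meet (Meet (Imp x y) x) y, Meet (Imp x y) x)
  | Ax_unit : heyting_axiom (Meet x (Imp y (Meet x y)), x)
  | Ax_mono : heyting_axiom
      (Meet (Imp x (Meet y z)) (Imp x z), Imp x (Meet y z)).

End HeytingAxioms.

Lemma heyting_equational (A : halg) :
  heyting A <-> satisfies_all A heyting_axiom.
Proof.
split=> [hA e|sat].
  case=> v /=.
  - exact: meetC.
  - exact: joinC.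
  - exact: meetA.
  - exact: joinA.
  - exact: meet_absorb.
  - exact: join_absorb.
  - exact: bot_least.
  - exact: top_greatest.
  - exact: imp_mp.
  - by apply: (hle_imp_intro hA); exact: hle_refl.
  - by apply: imp_homo => //; exact: meet_ler.
pose v (a b c : A) i := nth a [:: a; b; c] i.
have mC (a b : A) : meet a b = meet b a := sat _ Ax_meetC (v a b a).
have mA (a b c : A) : meet a (meet b c) = meet (meet a b) c :=
  sat _ Ax_meetA (v a b c).
have mp (a b : A) : meet (meet (imp a b) a) b = meet (imp a b) a :=
  sat _ Ax_mp (v a b a).
have unit (a b : A) : meet a (imp b (meet a b)) = a := sat _ Ax_unit (v a b a).
have mono (a b c : A) :
    meet (imp a (meet b c)) (imp a c) = imp a (meet b c) :=
  sat _ Ax_mono (v a b c).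
split=> //.
- by move=> a b; exact: (sat _ Ax_joinC (v a b a)).
- by move=> a b c; exact: (sat _ Ax_joinA (v a b c)).
- by move=> a b; exact: (sat _ Ax_meet_absorb (v a b a)).
- by move=> a b; exact: (sat _ Ax_join_absorb (v a b a)).
- by move=> a; exact: (sat _ Ax_bot (v a a a)).
- by move=> a; exact: (sat _ Ax_top (v a a a)).
- move=> a b c; rewrite /hle; split=> [abc|abc].
    (* [unit] puts [a] below [imp b (meet a b)]; since [meet a b = meet (meet a b) c], [mono] puts
       this below [imp b c]. *)
    by rewrite -{1}(unit a b) -abc -mA mono abc unit.
  (* With [a] replaced by [meet a (imp b c)], [mp] absorbs the final [c]. *)
  by rewrite -abc -!mA [meet (imp b c) (meet b c)]mA mp.
Qed.

Lemma variety_heyting : variety heyting.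
Proof.
have -> : heyting = fun A => satisfies_all A heyting_axiom.
  by apply/predeqP => A; exact: heyting_equational.
exact: variety_equational.
Qed.

Theorem theorem7p3 (n : nat) :
  (forall (k : nat) (le_ : 'I_k -> rel 'I_n.+1), po_enumeration le_ ->
     forall A : halg, heyting A ->
       (incomp_degree_le n A <-> satisfies_all A (Sigma le_))) /\
  variety (ID n).
Proof.
split=> [k le_ po A hA|]; first exact: incomp_degree_Sigma.
(* Any one enumeration turns the degree condition into a set of equations. *)
have [k [le_ po]] := po_enumeration_exists n.
have -> : ID n = fun A => heyting A /\ satisfies_all A (Sigma le_).
  by apply/predeqP => A; split=> -[hA /(incomp_degree_Sigma po hA)].
exact: variety_and variety_heyting (variety_equational _).
Qed.
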